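(* Let $G$ be a locally compact second countable group that admits a weak Følner sequence. Then $G$ also admits a strong Følner sequence.
   Context: $|\cdot|$ denotes left Haar measure on $G$. For compact $K\subset G$ and $F\subset G$ the $K$-boundary of $F$ is $\partial_K(F)=K^{-1}F\cap K^{-1}F^{\complement}$, where $F^{\complement}=G\setminus F$. A sequence $(F_n)$ of compact subsets of $G$ of positive Haar measure is (1) a weak Følner sequence if $|F_n\,\Delta\,KF_n|/|F_n|\to0$ for every compact $K\subset G$; (2) a strong Følner sequence if $|\partial_K(F_n)|/|F_n|\to 0$ for every compact $K\subset G$. *)

(* Defs.v *)
From HB Require Import structures.
From mathcomp Require Import all_boot all_order all_algebra.
From mathcomp Require Import all_classical all_reals all_analysis.

Set Implicit Arguments.
Unset Strict Implicit.
Unset Printing Implicit Defensive.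

Import Order.TTheory GRing.Theory Num.Theory.

Local Open Scope classical_set_scope.
Local Open Scope ring_scope.

HB.mixin Record isTopologicalGroup G & Topological G & Group G := {
  mulg_continuous : continuous (fun x : G * G => (x.1 * x.2)%g) ;
  invg_continuous : continuous (fun x : G => (x^-1)%g)
}.

#[short(type="topologicalGroupType")]
HB.structure Definition TopologicalGroup :=
  {G of Topological G & Group G & isTopologicalGroup G}.

(* [borel G] is [G] equipped with its Borel sigma-algebra. It is not
   [g_sigma_algebraType (@open G)] because the latter asks for a pointed type,
   whereas a group only gets a point from its unit. *)
Definition borel (G : topologicalGroupType) : Type := G.

HB.instance Definition _ (G : topologicalGroupType) := Choice.on (borel G).
HB.instance Definition _ (G : topologicalGroupType) :=
  isPointed.Build (borel G) (1%g : G).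

Fact borel_setC (G : topologicalGroupType) (A : set (borel G)) :
  <<s @open G >> A -> <<s @open G >> (~` A).
Proof. by move=> mA; rewrite -setTD; exact: sigma_algebraCD. Qed.

HB.instance Definition _ (G : topologicalGroupType) :=
  @isMeasurable.Build (sigma_display (@open G)) (borel G) <<s @open G >>
    (@sigma_algebra0 _ setT (@open G)) (@borel_setC G)
    (@sigma_algebra_bigcup _ setT (@open G)).

Definition mulset (G : groupType) (A B : set G) : set G :=
  [set (x * y)%g | x in A & y in B].

Definition invset (G : groupType) (A : set G) : set G :=
  [set (x^-1)%g | x in A].

Definition Kboundary (G : groupType) (K F : set G) : set G :=
  mulset (invset K) F `&` mulset (invset K) (~` F).

Section Haar.
Local Open Scope ereal_scope.

Record left_Haar_measure (R : realType) (G : topologicalGroupType)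
    (mu : {measure set (borel G) -> \bar R}) : Prop := {
  Haar_neq0 : mu setT != 0 ;
  Haar_left_invariant : forall (g : G) (A : set (borel G)),
    measurable A -> mu (mulset [set g] A) = mu A ;
  Haar_compact_lty : forall K : set G, compact K -> mu K < +oo ;
  Haar_outer_regular : forall A : set (borel G), measurable A ->
    mu A = ereal_inf [set mu U | U in [set U : set G | open U /\ A `<=` U]] ;
  Haar_inner_regular : forall U : set G, open U ->
    mu U = ereal_sup [set mu K | K in [set K : set G | compact K /\ K `<=` U]]
}.

(* [K] ranges over nonempty compact sets: for [K = set0] the ratio is
   constantly 1, so that no sequence at all would be weak Folner. *)
Definition weak_Folner (R : realType) (G : topologicalGroupType)
    (mu : {measure set (borel G) -> \bar R}) (F : nat -> set G) : Prop :=
  [/\ forall n, compact (F n),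
      forall n, 0 < mu (F n) &
      forall K : set G, compact K -> K !=set0 ->
        mu (F n `+` mulset K (F n)) / mu (F n) @[n --> \oo] --> 0].

Definition strong_Folner (R : realType) (G : topologicalGroupType)
    (mu : {measure set (borel G) -> \bar R}) (F : nat -> set G) : Prop :=
  [/\ forall n, compact (F n),
      forall n, 0 < mu (F n) &
      forall K : set G, compact K ->
        mu (Kboundary K (F n)) / mu (F n) @[n --> \oo] --> 0].

End Haar.

(* Main.v *)
Require Import Defs.
From HB Require Import structures.
From mathcomp Require Import all_boot all_order all_algebra.
From mathcomp Require Import all_classical all_reals all_analysis.

Set Implicit Arguments.
Unset Strict Implicit.
Unset Printing Implicit Defensive.

Import Order.TTheory GRing.Theory Num.Theory.

Local Open Scope classical_set_scope.
Local Open Scope ring_scope.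

(** If [F_n] is weak Folner and [L] is a compact neighbourhood of 1, then
[L F_n] is strong Folner. A point of the [K]-boundary of [L F] lying outside
[F] lies in [K^-1 L F \ F]. For a point [x] of [F] there is [k] in [K] with
[k x] outside [L F]; choosing [k_1, ..., k_N] in [K] with [K] covered by the
[L k_i] and [k] in [L k_i], we get that [k_i x] is outside [F]. Hence
[x] is in [F \ k_i^-1 F], whose measure is that of [k_i F \ F], at most the
measure of [F + K F] (symmetric difference). *)

Section TopologicalGroupSets.
Variable G : topologicalGroupType.
Implicit Types (A B F K L U : set G) (g x : G).

Lemma compact_mulset A B : compact A -> compact B -> compact (mulset A B).
Proof.
move=> cA cB.
have -> : mulset A B = (fun z : G * G => (z.1 * z.2)%g) @` (A `*` B).
  apply/seteqP; split => [_ [a Aa [b Bb <-]]|_ [[a b] [/= Aa Bb] <-]].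
    by exists (a, b).
  by exists a => //; exists b.
apply: continuous_compact; last exact: compact_setX.
by apply: continuous_subspaceT; exact: mulg_continuous.
Qed.

Lemma compact_invset A : compact A -> compact (invset A).
Proof.
move=> cA; apply: continuous_compact => //.
by apply: continuous_subspaceT; exact: invg_continuous.
Qed.

(** Preimages under left translations, rather than images, let openness of a product with an open
    set follow from continuity alone. *)
Lemma mulsetE A B : mulset A B =
  \bigcup_(a in A) ((fun x => (a^-1 * x)%g) @^-1` B).
Proof.
apply/seteqP; split => [_ [a Aa [b Bb <-]]|x [a Aa Bax]].
  by exists a => //=; rewrite mulKg.
by exists a => //; exists (a^-1 * x)%g => //; rewrite mulVKg.
Qed.

Lemma mulg_left_continuous g : continuous (fun x : G => (g * x)%g).
Proof.
move=> x; apply: (@continuous_comp _ _ _ (fun y : G => (g, y))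
  (fun z : G * G => (z.1 * z.2)%g)); last exact: mulg_continuous.
by apply: cvg_pair; [exact: cvg_cst|exact: cvg_id].
Qed.

Lemma mulg_right_continuous g : continuous (fun x : G => (x * g)%g).
Proof.
move=> x; apply: (@continuous_comp _ _ _ (fun y : G => (y, g))
  (fun z : G * G => (z.1 * z.2)%g)); last exact: mulg_continuous.
by apply: cvg_pair; [exact: cvg_id|exact: cvg_cst].
Qed.

Lemma open_mulset A U : open U -> open (mulset A U).
Proof.
move=> oU; rewrite mulsetE; apply: bigcup_open => a _.
by move/continuousP : (@mulg_left_continuous a^-1%g); exact.
Qed.

(** Since 1 is interior to [L], the open sets [L° k] with [k] in [K] cover [K], and a finite
    subcover provides [s]. The centres are kept in [K] so that each [k F] lies in [K F] later on. *)
Lemma compact_mulset_cover K L : compact K -> nbhs (1%g : G) L ->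
  exists2 s : seq G, {in s, forall k, K k} &
    forall x, K x -> exists2 k, k \in s & L (x * k^-1)%g.
Proof.
move=> cK L1.
have {}cK : cover_compact K.
  (* [compact_cover] asks for a pointed space. *)
  pose G' : ptopologicalType :=
    HB.pack_for ptopologicalType (TopologicalGroup.sort G)
      (TopologicalGroup.class G) (isPointed.Build G 1%g).
  by rewrite -(@compact_cover G').
pose f k := (fun x : G => (x * k^-1)%g) @^-1` L°.
have [k _|x Kx|s sK Ks] := cK _ K f.
- move/continuousP : (@mulg_right_continuous k^-1%g); apply.
  exact: open_interior.
- by exists x => //; rewrite /f /= mulgV; exact: nbhs_singleton (nbhs_interior L1).
exists (finmap.enum_fset s) => [k /sK|x /Ks[k sk fkx]]; first by rewrite inE.
by exists k => //; exact: interior_subset.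
Qed.

Lemma Kboundary_mulset_sub K L F (s : seq G) :
  (forall x, K x -> exists2 k, k \in s & L (x * k^-1)%g) ->
  Kboundary K (mulset L F) `<=`
    (F `+` mulset (mulset (invset K) L) F) `|`
    \big[setU/set0]_(k <- s) (F `\` mulset [set k^-1%g] F).
Proof.
move=> Ks x [[_ [k' Kk' <-] [_ [l Ll [f Ff <-]] k'lf]]].
move=> [_ [k Kk <-] [y nLFy kyx]].
have [Fx|nFx] := pselect (F x); last first.
  left; rewrite setY_def; right; split => //.
  exists (k'^-1 * l)%g; last by exists f => //; rewrite -mulgA.
  by exists k'^-1%g; [exists k'|exists l].
right; have [k1 sk1 Lk1] := Ks _ Kk.
rewrite -bigcup_seq; exists k1 => //; split => // -[_ -> [f' Ff' f'x]].
(* If [x = k1^-1 f'] with [f'] in [F], then [y = k x = (k k1^-1) f'] would lie in [L F]. *)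
apply: nLFy; exists (k * k1^-1)%g => //; exists f' => //.
by rewrite -mulgA f'x -kyx mulVKg.
Qed.

Lemma compact_measurable K : hausdorff_space G -> compact K ->
  measurable (K : set (borel G)).
Proof.
move=> hG /(compact_closed hG) cK.
rewrite -[K]setCK; apply: measurableC.
by apply: sub_sigma_algebra; rewrite /= openC.
Qed.

Lemma open_measurable_borel U : open U -> measurable (U : set (borel G)).
Proof. by move=> oU; exact: sub_sigma_algebra. Qed.

End TopologicalGroupSets.

Section Bounds.
Local Open Scope ereal_scope.

Lemma measure_bigsetU_le d (T : ringOfSetsType d) (R : realType)
    (mu : {measure set T -> \bar R}) (I : eqType) (s : seq I)
    (A : I -> set T) (c : \bar R) :
  {in s, forall i, measurable (A i)} -> {in s, forall i, mu (A i) <= c} ->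
  mu (\big[setU/set0]_(i <- s) A i) <= \sum_(i <- s) c.
Proof.
elim: s => [|i s IHs] mA Ac; first by rewrite !big_nil measure0.
have mAs : {in s, forall j, measurable (A j)}.
  by move=> j js; apply: mA; rewrite inE js orbT.
rewrite !big_cons (le_trans (measureU2 _ _ _))//.
- by apply: mA; rewrite inE eqxx.
- by rewrite big_seq; apply: bigsetU_measurable.
apply: leeD; first by apply: Ac; rewrite inE eqxx.
by apply: IHs => // j js; apply: Ac; rewrite inE js orbT.
Qed.

Variables (R : realType) (G : topologicalGroupType).
Variable mu : {measure set (borel G) -> \bar R}.
Hypotheses (hG : hausdorff_space G) (mu_Haar : left_Haar_measure mu).

Let mcompact (K : set G) : compact K -> measurable (K : set (borel G)).
Proof. exact: compact_measurable. Qed.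

Lemma measure_setD_translate_le (K F : set G) (k : G) :
  compact K -> compact F -> K k ->
  mu (F `\` mulset [set k^-1%g] F) <= mu (F `+` mulset K F).
Proof.
move=> cK cF Kk.
have mF := mcompact cF; have mKF := mcompact (compact_mulset cK cF).
have mkF (g : G) : measurable (mulset [set g] F : set (borel G)).
  by apply: mcompact; apply: compact_mulset => //; exact: compact_set1.
(* Left translation by [k] carries [F \ k^-1 F] onto [k F \ F], which is contained in [K F \ F]. *)
have <- : mu (mulset [set k] F `\` F) = mu (F `\` mulset [set k^-1%g] F).
  rewrite -[RHS](Haar_left_invariant mu_Haar k); last exact: measurableD.
  congr (mu _).
  apply/seteqP; split => [_ [[_ -> [x Fx <-]] nFkx]|_ [_ -> [x [Fx nFx] <-]]].
    exists k => //; exists x => //; split => // -[_ -> [y Fy yx]].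
    by apply: nFkx; rewrite -yx mulVKg.
  split; first by exists k => //; exists x.
  move=> Fkx; apply: nFx; exists k^-1%g => //; exists (k * x)%g => //.
  by rewrite mulKg.
apply: le_measure; rewrite ?inE; first exact: measurableD.
  by rewrite setY_def; apply: measurableU; exact: measurableD.
move=> _ [[_ -> [x Fx <-]] nFkx]; rewrite setY_def; right; split => //.
by exists k => //; exists x.
Qed.

(** All pieces indexed by [s] share one bound, and the covering condition on [s] involves only [K]
    and [L]. The same [s] therefore serves every term of a Følner sequence. *)
Lemma measure_Kboundary_mulset_le (K L F : set G) (s : seq G) :
  compact K -> compact L -> compact F -> {in s, forall k, K k} ->
  (forall x, K x -> exists2 k, k \in s & L (x * k^-1)%g) ->
  mu (Kboundary K (mulset L F)) <=
    mu (F `+` mulset (mulset (invset K) L) F) +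
    \sum_(k <- s) mu (F `+` mulset K F).
Proof.
move=> cK cL cF sK Ks.
have cKi := compact_invset cK; have cLF := compact_mulset cL cF.
have cKLF := compact_mulset (compact_mulset cKi cL) cF.
have mkF (k : G) :
    measurable (F `\` mulset [set k^-1%g] F : set (borel G)).
  apply: measurableD; apply: mcompact => //; apply: compact_mulset => //.
  exact: compact_set1.
have mY : measurable
    (F `+` mulset (mulset (invset K) L) F : set (borel G)).
  by rewrite setY_def; apply: measurableU; apply: measurableD; exact: mcompact.
have mU : measurable
    (\big[setU/set0]_(k <- s) (F `\` mulset [set k^-1%g] F) : set (borel G)).
  by apply: bigsetU_measurable => k _; exact: mkF.
apply: (@le_trans _ _ (mu
    ((F `+` mulset (mulset (invset K) L) F) `|`
    \big[setU/set0]_(k <- s) (F `\` mulset [set k^-1%g] F)))).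
  apply: le_measure; rewrite ?inE.
  (* The boundary is Borel as the intersection of the compact set [K^-1 L F] with the product of
     [K^-1] and the complement of [L F], which is open because [L F] is closed. *)
  - apply: measurableI; first by apply: mcompact; exact: compact_mulset.
    apply: open_measurable_borel; apply: open_mulset; rewrite openC.
    exact: compact_closed.
  - exact: measurableU.
  - exact: Kboundary_mulset_sub.
rewrite (le_trans (measureU2 _ _ _))// leeD2l//.
apply: (measure_bigsetU_le (T := borel G)) => k sk //.
exact/measure_setD_translate_le/sK.
Qed.

End Bounds.

Theorem lemma2p2 (R : realType) (G : topologicalGroupType)
    (mu : {measure set (borel G) -> \bar R})
    (G_hausdorff : hausdorff_space G)
    (G_locally_compact : locally_compact [set: G])
    (G_second_countable : @second_countable G)
    (mu_Haar : left_Haar_measure mu) :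
  (exists F : nat -> set G, weak_Folner mu F) ->
  exists F : nat -> set G, strong_Folner mu F.
Proof.
move=> [F [cF F0 FK]].
have [L L1 [cL _]] : exists2 L : set G, nbhs (1%g : G) L & compact L /\ closed L.
  have [V + [cV clV]] := G_locally_compact 1%g I.
  by rewrite withinET => V1; exists V.
have cLF n : compact (mulset L (F n)) by exact: compact_mulset.
(* As 1 is in [L], [F n] is contained in [L F n]. This gives positivity of the new measures and
   later allows the denominator to be replaced by [mu (F n)]. *)
have F_le_LF n : (mu (F n) <= mu (mulset L (F n)))%E.
  apply: le_measure; rewrite ?inE; [exact: compact_measurable..|].
  move=> x Fx; exists 1%g; first exact: nbhs_singleton.
  by exists x => //; rewrite mul1g.
exists (fun n => mulset L (F n)); split => // [n|K cK].
  exact: lt_le_trans (F_le_LF n).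
(* [FK] covers nonempty compact sets only; for empty [K] the boundary itself is empty. *)
have [->|/set0P K0] := eqVneq K set0.
  under eq_fun => n.
    rewrite (_ : Kboundary _ _ = set0) ?measure0 ?mul0e; first over.
    by apply/seteqP; split => // x [[_ [k []]]].
  exact: cvg_cst.
have [s sK Ks] := compact_mulset_cover cK L1.
have KL0 : mulset (invset K) L !=set0.
  case: K0 => k Kk; exists (k^-1 * 1)%g; exists k^-1%g; first by exists k.
  by exists 1%g => //; exact: nbhs_singleton.
have cKL := compact_mulset (compact_invset cK) cL.
have Finv0 n : (0 <= (mu (F n))^-1)%E by rewrite inve_ge0.
(* The majorant tends to 0 term by term: [FK] is applied to [K^-1 L] for the first summand and to
   [K] for the others, whose number does not depend on [n]. *)
apply: (@squeeze_cvge _ _ _ _ (cst 0%E) _ (fun n =>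
    mu (F n `+` mulset (mulset (invset K) L) (F n)) / mu (F n) +
    \sum_(k <- s) (mu (F n `+` mulset K (F n)) / mu (F n)))%E).
- apply: nearW => n; apply/andP; split.
    by rewrite mule_ge0// inve_ge0.
  (* Factoring out the inverse of [mu (F n)] leaves two comparisons, one of numerators and one of
     inverse measures. *)
  rewrite -ge0_sume_distrl// -ge0_muleDl ?sume_ge0//.
  apply: lee_pmul => //; rewrite ?inve_ge0//.
    exact: measure_Kboundary_mulset_le.
  by rewrite lee_pV2 ?inE.
- exact: cvg_cst.
- rewrite [X in _ --> X](_ : _ = 0 + \sum_(k <- s) 0)%E; last first.
    by rewrite big1// adde0.
  apply: cvgeD; first by rewrite big1.
    exact: FK.
  apply: cvg_nnesum => k _; last exact: FK.
  by apply: nearW => n; rewrite mule_ge0.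
Qed.
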